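(* Let $\alpha_n=n^\omega$ and $M_n=n^b$, where $0<\omega<1$, $b<1$ and $\omega<b$. Then $\frac{\epsilon^*_{M_n}}{\epsilon^*_n}\to0$ as $n\to\infty$.
   Context: Here $a,c,c_1>0$ are constants, $G_0$ is a probability measure on $\mathbb R$ with compact support containing $[-a-c,a+c]$, $H_0=G_0([-a-c,a+c])>0$, $\epsilon_n\in(0,1)$ and $b_n>0$ are sequences (the same in both quantities), and $$\epsilon_n^*=\frac{\epsilon_n}{1-\epsilon_n}\exp\left(\frac{n(a+c_1)^2}{2b_n^2}\right)\frac{(\alpha_n+n)^n}{\alpha_n^nH_0^n},\qquad\epsilon^*_{M_n}=\frac{\epsilon_n}{1-\epsilon_n}\exp\left(\frac{n(a+c_1)^2}{2b_n^2}\right)\frac{(\alpha_n+M_n)^{M_n}}{\alpha_n^{M_n}H_0^{M_n}}.$$ *)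

(* Defs.v *)
From HB Require Import structures.
From mathcomp Require Import all_boot all_order all_algebra.
From mathcomp Require Import all_classical all_reals all_analysis.
Set Implicit Arguments.
Unset Strict Implicit.
Unset Printing Implicit Defensive.
Import Order.TTheory GRing.Theory Num.Theory.
Import numFieldNormedType.Exports.
Local Open Scope classical_set_scope.
Local Open Scope ring_scope.

Definition msupport (R : realType)
    (G : probability (measurableTypeR R) R) : set R :=
  [set x | forall U : set R, open_nbhs x U -> (0 < G U)%E].

Definition central_mass (R : realType)
    (G : probability (measurableTypeR R) R) (a c : R) : R :=
  fine (G `[- a - c, a + c]%classic).

Definition eps_star (R : realType) (a c1 H : R) (eps b_ alpha : nat -> R)
    (n : nat) : R :=
  eps n / (1 - eps n)
  * expR (n%:R * (a + c1) ^+ 2 / (2 * b_ n ^+ 2))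
  * ((alpha n + n%:R) ^+ n / (alpha n ^+ n * H ^+ n)).

(* M n is not rounded to an integer, so the exponents are real powers. *)
Definition eps_star_M (R : realType) (a c1 H : R) (eps b_ alpha M : nat -> R)
    (n : nat) : R :=
  eps n / (1 - eps n)
  * expR (n%:R * (a + c1) ^+ 2 / (2 * b_ n ^+ 2))
  * ((alpha n + M n) `^ M n / (alpha n `^ M n * H `^ M n)).

(* Main.v *)
(** The factors involving [eps] and [b_] cancel in the quotient, which is
    X^M / Y^n with X = (alpha + M)/(alpha H), Y = (alpha + n)/(alpha H).
    Since M <= n, alpha <= n and H <= 1, one has X <= Y and 2 <= Y, so the
    quotient is at most Y^(M - n) <= 2^(M - n). By weighted AM-GM,
    n^b <= b n + (1 - b), i.e. M - n <= (b - 1)(n - 1), and the quotient is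
    dominated by a geometric sequence. *)

Require Import Defs.
From HB Require Import structures.
From mathcomp Require Import all_boot all_order all_algebra.
From mathcomp Require Import all_classical all_reals all_analysis.
From mathcomp Require Import lra.
Import Order.TTheory GRing.Theory Num.Theory.
Import numFieldNormedType.Exports.
Local Open Scope classical_set_scope.
Local Open Scope ring_scope.

Lemma powR_le_affine (R : realType) (x b : R) :
  0 <= x -> 0 < b < 1 -> x `^ b <= b * x + (1 - b).
Proof.
move=> x0 /andP[b0 b1].
have b'0 : 0 < 1 - b by rewrite subr_gt0.
have := @conjugate_powR R (x `^ b) 1 b^-1 (1 - b)^-1 (powR_ge0 _ _) ler01.
rewrite !invr_gt0 !invrK -powRrM divff ?gt_eqF// powRr1// powR1.
by rewrite mul1r mulr1 [x * b]mulrC; apply => //; lra.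
Qed.

Lemma powR_div_le (R : realType) (z x y p q : R) :
    0 < z -> z <= y -> 0 <= x <= y -> 0 <= p <= q ->
  x `^ p / y `^ q <= z `^ (p - q).
Proof.
move=> z0 zy /andP[x0 xy] /andP[p0 pq].
have y0 : 0 < y by exact: lt_le_trans zy.
apply: (@le_trans _ _ (y `^ p / y `^ q)).
  rewrite ler_wpM2r ?invr_ge0 ?powR_ge0//.
  by apply: ge0_ler_powR; rewrite // nnegrE ltW.
have yN0 : y != 0 by rewrite gt_eqF.
(* Inverting both sides turns the exponent into [q - p >= 0], where the power is monotone in its
   base. *)
rewrite -powRB ?yN0 ?implybT// -opprB !powRN lef_pV2 ?posrE ?powR_gt0//.
by apply: ge0_ler_powR; rewrite ?subr_ge0// nnegrE ltW.
Qed.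

Lemma central_mass_le1 (R : realType) (G : probability (measurableTypeR R) R)
  (a c : R) : central_mass G a c <= 1.
Proof.
have mI : measurable (`[- a - c, a + c]%classic : set (measurableTypeR R)).
  exact: measurable_itv.
have fG : G `[- a - c, a + c]%classic \is a fin_num by exact: fin_num_measure.
by rewrite -lee_fin /central_mass fineK// probability_le1.
Qed.

(** The shared prefactor is positive because [0 < eps n < 1], hence cancels. The natural power is
    recast as a real one so that [powR_div_le] applies. *)
Lemma eps_star_ratio (R : realType) (a c1 H : R) (eps b_ alpha M : nat -> R)
    (n : nat) :
    0 < H -> 0 < eps n < 1 -> 0 < alpha n -> 0 <= M n ->
  eps_star_M a c1 H eps b_ alpha M n / eps_star a c1 H eps b_ alpha n =
  ((alpha n + M n) / (alpha n * H)) `^ M n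
    / ((alpha n + n%:R) / (alpha n * H)) `^ n%:R.
Proof.
move=> H0 /andP[e0 e1] al0 M0; rewrite /eps_star_M /eps_star.
have k0 : eps n / (1 - eps n)
    * expR (n%:R * (a + c1) ^+ 2 / (2 * b_ n ^+ 2)) != 0.
  by rewrite gt_eqF// mulr_gt0 ?expR_gt0// divr_gt0 ?subr_gt0.
rewrite -mulf_div divff// mul1r.
have aH0 : 0 < alpha n * H by exact: mulr_gt0.
congr (_ / _); last first.
  by rewrite powR_mulrn ?divr_ge0 ?addr_ge0 ?(ltW al0) ?(ltW aH0)// expr_div_n exprMn.
rewrite powRM ?invr_ge0 ?addr_ge0 ?(ltW al0) ?(ltW aH0)//; congr (_ * _).
rewrite -powRM ?(ltW al0) ?(ltW H0)//.
by rewrite -[(_ * _)^-1]powR_inv1 ?(ltW aH0)// powRAC powR_inv1 ?powR_ge0.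
Qed.

Theorem lemma7p1 (R : realType) (a c c1 : R)
    (a_gt0 : 0 < a) (c_gt0 : 0 < c) (c1_gt0 : 0 < c1)
    (G0 : probability (measurableTypeR R) R)
    (G0_compact : compact (msupport G0))
    (G0_support : `[- a - c, a + c]%classic `<=` msupport G0)
    (H0_gt0 : 0 < central_mass G0 a c)
    (eps b_ : nat -> R)
    (eps_itv : forall n, (0 < n)%N -> 0 < eps n < 1)
    (b_gt0 : forall n, (0 < n)%N -> 0 < b_ n)
    (omega b : R) (omega_itv : 0 < omega < 1) (b_lt1 : b < 1)
    (omega_lt_b : omega < b)
    (alpha M : nat -> R)
    (alphaE : forall n, (0 < n)%N -> alpha n = n%:R `^ omega)
    (ME : forall n, (0 < n)%N -> M n = n%:R `^ b) :
  eps_star_M a c1 (central_mass G0 a c) eps b_ alpha M n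
    / eps_star a c1 (central_mass G0 a c) eps b_ alpha n
    @[n --> \oo] --> (0 : R).
Proof.
have [w0 w1] := andP omega_itv.
have b01 : 0 < b < 1 by rewrite b_lt1 (lt_trans w0).
set H := central_mass G0 a c.
have H1 : H <= 1 by exact: central_mass_le1.
pose q : R := 2 `^ (b - 1).
have q0 : 0 < q by rewrite powR_gt0.
have q1 : q < 1.
  rewrite /q -opprB powRN invf_lt1 ?powR_gt0//.
  suff : 1 `^ (1 - b) < 2 `^ (1 - b) :> R by rewrite powR1.
  by apply: gt0_ltr_powR; rewrite ?subr_gt0// ?nnegrE// ltr1n.
(* The factor [q^-1] accounts for the exponent [n - 1], rather than [n], in the weighted AM-GM
   bound. *)
apply: (@squeeze_cvgr _ _ _ _ (fun=> 0) (fun n => q^-1 * q ^+ n)); last 2 first.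
- exact: cvg_cst.
- rewrite -[X in _ --> X](mulr0 q^-1).
  by apply: cvgM; [exact: cvg_cst|apply: cvg_expr; rewrite gtr0_norm].
near=> n.
have n0 : (0 < n)%N by near: n; exact: nbhs_infty_gt.
have n1 : 1 <= n%:R :> R by rewrite ler1n.
have nR0 : 0 < n%:R :> R by rewrite ltr0n.
have al0 : 0 < alpha n by rewrite alphaE// powR_gt0.
have M0 : 0 <= M n by rewrite ME// powR_ge0.
have aln : alpha n <= n%:R by rewrite alphaE// ler1_powR// ltW.
have Mn : M n <= n%:R by rewrite ME// ler1_powR// ltW.
have aH0 : 0 < alpha n * H by exact: mulr_gt0.
rewrite eps_star_ratio ?eps_itv//; apply/andP; split.
  by rewrite divr_ge0 ?powR_ge0.
apply: (le_trans (powR_div_le R 2 _ _ _ _ _ _ _ _)) => //.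
(* The bound [2 <= Y] amounts to [2 * (alpha n * H) <= alpha n + n], which follows from [H <= 1] and
   [alpha n <= n]. *)
- rewrite ler_pdivlMr//.
  have : alpha n * H <= alpha n by rewrite ler_piMr// ltW.
  lra.
- by rewrite divr_ge0 ?addr_ge0 ?(ltW al0) ?(ltW aH0)//= ler_pM2r ?invr_gt0// lerD2l.
- by rewrite M0.
have -> : q^-1 * q ^+ n = 2 `^ ((b - 1) * (n%:R - 1)).
  rewrite powRrM powRB ?(gt_eqF q0) ?implybT// powR_mulrn ?powR_ge0//.
  by rewrite powRr1 ?powR_ge0// mulrC.
(* As the base 2 is at least 1, it suffices to compare exponents: [n^b - n <= (b - 1)(n - 1)]. *)
rewrite ler_powR ?ler1n// ME//.
have := @powR_le_affine R _ _ (ltW nR0) b01.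
lra.
Unshelve. all: by end_near.
Qed.
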